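(* Let $H$ be a finite poset whose Hasse diagram is a tree and whose height is $k\geq 2$. Let $\epsilon$ be a (small) positive real. Then for every positive integer $n$ sufficiently large depending on $H$ and $\epsilon$, every family $\mathcal{F}\subseteq 2^{[n]}$ with $|\mathcal{F}|\geq (k-1+\epsilon)\binom{n}{\lfloor n/2\rfloor}$ contains $H$ as an induced subposet.
   Context: $[n]=\{1,\dots,n\}$; families $\mathcal{F}\subseteq 2^{[n]}$ are regarded as posets under $\subseteq$. The height of a poset is the largest cardinality of a chain in it. A poset $G=(S,\leq)$ contains $H=(S',\leq')$ as an induced subposet if there is an injection $f:S'\to S$ such that for all $u,v\in S'$, $u\leq' v$ if and only if $f(u)\leq f(v)$. *)

(* Defs.v *)
From mathcomp Require Import all_boot all_order all_algebra.
From mathcomp Require Import reals.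

Set Implicit Arguments.
Unset Strict Implicit.
Unset Printing Implicit Defensive.

(* For a symmetric irreflexive relation, viewed as a simple graph.  Cycles need
   size > 2 because [ucycle e [:: x; y]] holds for every edge xy.             *)
Definition is_tree (V : finType) (e : rel V) : Prop :=
  [/\ (0 < #|V|)%N,
      forall x y : V, connect e x y &
      forall s : seq V, (2 < size s)%N -> ~ ucycle e s].

Definition covers d (H : finPOrderType d) : rel H :=
  fun x y => (x < y)%O && ~~ [exists z : H, (x < z)%O && (z < y)%O].

Definition hasse d (H : finPOrderType d) : rel H :=
  fun x y => covers x y || covers y x.

Definition is_chain d (H : finPOrderType d) (C : {set H}) : bool :=
  [forall x in C, forall y in C, (x <= y)%O || (y <= x)%O].

Definition height d (H : finPOrderType d) : nat :=
  \max_(C : {set H} | is_chain C) #|C|.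

Definition contains_induced d (H : finPOrderType d) (T : finType)
    (F : {set {set T}}) : Prop :=
  exists f : H -> {set T},
    [/\ injective f,
        forall u, f u \in F &
        forall u v, (u <= v)%O <-> f u \subset f v].

(* Main.v *)
(* On a random full chain of the cube, the expected number of members of the
   middle part of F exceeds k - 1 by a constant, so among the pairs (full chain,
   k consecutive members of F on it) one can delete those through "infrequent"
   sets and keep a nonempty collection in which every set A occurring at level i
   does so for a constant proportion of the full chains through A.  The tree H is
   then embedded one vertex at a time, each vertex x at its level in H.  If v is
   attached to u, already sent to A, then the image of v is read off a chain
   through A.  All sets have sizes within o(n) of n/2, and for such a set B the
   next few steps of a random chain through A create or destroy an inclusion with
   B only if some element falls in one of o(n) prescribed positions, which has
   small probability; hence a chain avoiding all unwanted inclusions is left.   *)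
Require Import Defs.
From mathcomp Require Import all_boot all_order all_algebra all_fingroup.
From mathcomp Require Import reals.
From mathcomp Require Import zify.

Set Implicit Arguments.
Unset Strict Implicit.
Unset Printing Implicit Defensive.

Import Order.TTheory GRing.Theory Num.Theory.

(** * Attaching a vertex to a subtree of the Hasse diagram *)

(** Otherwise a simple path from [z] to [u] avoiding [v], closed up through [v], is a cycle on at
    least three vertices. *)
Lemma acyclic_nbr_unique (V : finType) (e : rel V) (v z u : V) :
    (forall s : seq V, 2 < size s -> ~ ucycle e s) ->
    e v z -> e u v -> connect [rel x y | [&& e x y, x != v & y != v]] z u ->
  z = u.
Proof.
move=> acyc evz euv /connectP [p0 path_p0 u_last].
have [//|zNu] := eqVneq z u; exfalso.
move: path_p0 u_last => /shortenP [p path_p uniq_p _] u_last.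
case: p path_p uniq_p u_last => [|y p] path_p uniq_p u_last.
  by rewrite u_last eqxx in zNu.
have vNzp : v \notin [:: z, y & p].
  move: path_p => /= /andP [/and3P [_ zNv yNv]].
  rewrite !inE !negb_or eq_sym zNv eq_sym yNv /=.
  elim: p y {uniq_p u_last yNv} => //= x p IH y /andP [/and3P [_ _ xNv] pp].
  by rewrite inE negb_or eq_sym xNv (IH x).
apply: (acyc [:: v, z, y & p]) => //.
have path_e : path e z (y :: p) by apply: sub_path path_p => a b /and3P [].
apply/andP; split; last by apply/andP.
by change (e v z && path e z (rcons (y :: p) v)); rewrite rcons_path evz path_e -u_last.
Qed.

Lemma cover_above d (H : finPOrderType d) (x y : H) :
  (x < y)%O -> exists2 z, covers x z & (z <= y)%O.
Proof.
move=> xy; pose P z := (x < z)%O && (z <= y)%O.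
have Py : P y by rewrite /P xy lexx.
case: (arg_minnP (fun z => #|[set t : H | (x < t)%O && (t < z)%O]|) Py).
move=> z /andP [xz zy] zmin; exists z => //; rewrite /covers xz /=.
apply/existsP => - [t /andP [xt tz]].
have := zmin t; rewrite /P xt (le_trans (ltW tz) zy) => /(_ isT).
rewrite leqNgt => /negP []; apply/proper_card/properP; split.
  by apply/subsetP => r; rewrite !inE => /andP [-> /lt_trans ->].
by exists t; rewrite inE xt ?tz // ltxx.
Qed.

Lemma cover_below d (H : finPOrderType d) (x y : H) :
  (x < y)%O -> exists2 z, covers z y & (x <= z)%O.
Proof.
move=> xy; pose P z := (x <= z)%O && (z < y)%O.
have Px : P x by rewrite /P xy lexx.
case: (arg_minnP (fun z => #|[set t : H | (z < t)%O && (t < y)%O]|) Px).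
move=> z /andP [xz zy] zmin; exists z => //; rewrite /covers zy /=.
apply/existsP => - [t /andP [zt ty]].
have := zmin t; rewrite /P ty (le_trans xz (ltW zt)) => /(_ isT).
rewrite leqNgt => /negP []; apply/proper_card/properP; split.
  by apply/subsetP => r; rewrite !inE => /andP [/(lt_trans zt) -> ->].
by exists t; rewrite inE ty ?zt // ltxx.
Qed.

(** Climbing from [x] by covers never leaves the interval from [x] to [y]. The restriction to [P]
    later keeps the path away from the vertex being attached. *)
Lemma le_connect_hasse d (H : finPOrderType d) (P : pred H) (x y : H) :
    (x <= y)%O -> (forall z, (x <= z)%O -> (z <= y)%O -> P z) ->
  connect [rel a b | [&& hasse a b, P a & P b]] x y.
Proof.
have [N leN] := ubnP #|[set t : H | (x <= t)%O]|.
elim: N x leN => // N IH x leN xy Pxy.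
have [->|xNy] := eqVneq x y; first exact: connect0.
have /cover_above [z xz zy] : (x < y)%O by rewrite lt_neqAle xNy.
have ltxz : (x < z)%O by case/andP: xz.
apply: (@connect_trans _ _ z); last first.
  apply: IH => // [|t zt]; last by apply/Pxy/ltW/(lt_le_trans ltxz).
  rewrite ltnS in leN; apply: leq_trans leN.
  apply/proper_card/properP; split; last first.
    by exists x; rewrite !inE ?lexx // lt_geF.
  by apply/subsetP => r; rewrite !inE; apply/le_trans/ltW.
apply: connect1 => /=; rewrite /hasse xz /=.
by rewrite !Pxy ?lexx // ltW.
Qed.

Lemma hasse_sym d (H : finPOrderType d) : symmetric (@hasse d H).
Proof. by move=> x y; rewrite /hasse orbC. Qed.

Lemma restr_sym (V : finType) (e : rel V) (P : pred V) :
  symmetric e -> connect_sym [rel a b | [&& e a b, P a & P b]].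
Proof.
by move=> esym; apply: sym_connect_sym => x y /=; rewrite esym [P x && _]andbC.
Qed.

(* [v] is attached to the subtree [S] by the single Hasse edge [uv], so every
   comparability between [v] and [S] has to pass through [u].                 *)
Lemma attached_comparable d (H : finPOrderType d) (S : {set H}) (u v w : H) :
    is_tree (@hasse d H) -> hasse u v -> v \notin S -> w \in S ->
    connect [rel a b | [&& hasse a b, a \in S & b \in S]] w u ->
  ((v < w)%O -> covers v u && (u <= w)%O) /\
  ((w < v)%O -> covers u v && (w <= u)%O).
Proof.
move=> [_ _ acyc] uv vNS wS wu.
have csym := restr_sym (predC1 v) (@hasse_sym d H).
have {}wu : connect [rel a b | [&& hasse a b, a != v & b != v]] w u.
  apply: connect_sub wu => a b /= /and3P [ab aS bS]; apply: connect1 => /=.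
  by rewrite ab /=; apply/andP; split; apply: contraNneq vNS => <-.
split=> [vw|wv].
- have [z vz zw] := cover_above vw.
  suff <- : z = u by rewrite vz zw.
  apply: (acyclic_nbr_unique acyc _ uv); first by rewrite /hasse vz.
  apply: connect_trans wu; apply: (@le_connect_hasse _ _ (predC1 v)) => // t zt _.
  by rewrite /= gt_eqF // (lt_le_trans _ zt) //; case/andP: vz.
- have [z zv wz] := cover_below wv.
  suff <- : z = u by rewrite zv wz.
  apply: (acyclic_nbr_unique acyc _ uv); first by rewrite hasse_sym /hasse zv.
  apply: connect_trans wu; rewrite csym.
  apply: (@le_connect_hasse _ _ (predC1 v)) => // t _ tz.
  by rewrite /= lt_eqF // (le_lt_trans tz) //; case/andP: zv.
Qed.

Lemma connected_set_grows (V : finType) (e : rel V) (S : {set V}) (x : V) :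
    (forall x y, connect e x y) -> x \in S -> S != setT ->
  exists u v, [/\ e u v, u \in S & v \notin S].
Proof.
move=> econ xS; rewrite -subTset => /subsetPn [y _ yNS].
case/connectP: (econ x y) => p; elim: p x xS => [|z p IH] x xS /=.
  by move=> _ yx; rewrite yx xS in yNS.
case/andP => xz pp yl; have [zS|zNS] := boolP (z \in S); first exact: (IH z).
by exists x, z.
Qed.

(** Rank counted from 0, so that its values are exactly usable as places in a window of [height H]
    consecutive members. *)
Definition level d (H : finPOrderType d) (x : H) : nat :=
  \max_(C : {set H} | is_chain C && [forall y in C, (y < x)%O]) #|C|.

Lemma is_chainU1 d (H : finPOrderType d) (C : {set H}) (x : H) :
  is_chain C -> (forall y, y \in C -> (y < x)%O) -> is_chain (x |: C).
Proof.
move=> /forall_inP chC ltx; apply/forall_inP => a; rewrite !inE => aC.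
apply/forall_inP => b; rewrite !inE => bC.
case/predU1P: aC => [->|aC]; case/predU1P: bC => [->|bC].
- by rewrite lexx.
- by rewrite (ltW (ltx b bC)) orbT.
- by rewrite (ltW (ltx a aC)).
- by move/forall_inP: (chC a aC); apply.
Qed.

Lemma level_attained d (H : finPOrderType d) (x : H) :
  exists C : {set H}, [/\ is_chain C, forall y, y \in C -> (y < x)%O & #|C| = level x].
Proof.
pose P (C : {set H}) := is_chain C && [forall y in C, (y < x)%O].
have P0 : 0 < #|P|.
  apply/card_gt0P; exists set0; rewrite unfold_in.
  by apply/andP; split; apply/forall_inP => y; rewrite inE.
rewrite /level.
have [C /andP [chC /forall_inP ltC] ->] := eq_bigmax_cond (fun C : {set H} => #|C|) P0.
by exists C.
Qed.

Lemma level_lt_height d (H : finPOrderType d) (x : H) : level x < height H.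
Proof.
have [C [chC ltC <-]] := level_attained x.
have xNC : x \notin C by apply/negP => /ltC; rewrite ltxx.
have <- : #|x |: C| = #|C|.+1 by rewrite cardsU1 xNC.
rewrite /height (@leq_bigmax_cond _ _ (fun C : {set H} => #|C|)) //.
exact: is_chainU1.
Qed.

Lemma level_lt d (H : finPOrderType d) (x y : H) : (x < y)%O -> level x < level y.
Proof.
move=> xy; have [C [chC ltC <-]] := level_attained x.
have xNC : x \notin C by apply/negP => /ltC; rewrite ltxx.
have <- : #|x |: C| = #|C|.+1 by rewrite cardsU1 xNC.
rewrite [leqRHS]/level (@leq_bigmax_cond _ _ (fun C : {set H} => #|C|)) //.
rewrite is_chainU1 //=; apply/forall_inP => z; rewrite in_setU1.
by case/predU1P => [->//|/ltC /lt_trans ->].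
Qed.

(** Here [good i A] abstracts that [A] stands at place [i] of some kept window. A new image [D] may
    be comparable to placed sets only as forced through its neighbour's image [A]; by
    [attached_comparable] this is what the order of [H] demands. *)
Lemma tree_embedding d (H : finPOrderType d) (T : finType) (F : {set {set T}})
    (good : nat -> {set T} -> Prop) :
    is_tree (@hasse d H) ->
    (forall i A, good i A -> A \in F) ->
    (forall i, i < height H -> exists A, good i A) ->
    (forall i j A (B : H -> {set T}), good i A -> j < i -> i < height H ->
       (forall w, B w \in F) ->
       exists D, [/\ good j D, D \subset A &
         forall w, (D \subset B w -> A \subset B w) /\ ~~ (B w \subset D)]) ->
    (forall i j A (B : H -> {set T}), good i A -> i < j -> j < height H ->
       (forall w, B w \in F) ->
       exists D, [/\ good j D, A \subset D &
         forall w, (B w \subset D -> B w \subset A) /\ ~~ (D \subset B w)]) ->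
  contains_induced H F.
Proof.
move=> tree goodF base down up.
have [/card_gt0P [x0 _] econ _] := tree.
pose in_S (S : {set H}) := [rel a b | [&& hasse a b, a \in S & b \in S]].
(* Vertices are added one at a time, keeping [S] connected as [attached_comparable] requires. The
   values of [f] lie in [F] even off [S], so the whole of [f] can serve as [B] in [down] and
   [up]. *)
suff ind m : m < #|H| -> exists (S : {set H}) (f : H -> {set T}),
    [/\ #|S| = m.+1, {in S &, forall x y, connect (in_S S) x y},
      forall w, f w \in F, {in S, forall w, good (level w) (f w)} &
      {in S &, forall x y, (x <= y)%O = (f x \subset f y)}].
  have H0 : 0 < #|H| by apply/card_gt0P; exists x0.
  have [|S [f [cardS _ fF _ fS]]] := ind #|H|.-1; first by rewrite prednK.
  have ST : S = setT by apply/eqP; rewrite eqEcard subsetT cardsT cardS prednK ?leqnn.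
  have fle x y : (x <= y)%O = (f x \subset f y) by rewrite fS // ST inE.
  exists f; split=> // [x y fxy|u v]; last by rewrite fle.
  by apply/le_anti; rewrite !fle fxy subxx.
elim: m => [_|m IH mH].
  have [A gA] := base _ (level_lt_height x0).
  exists [set x0], (fun=> A); split=> [|x y|w|w|x y].
  - by rewrite cards1.
  - by rewrite !inE => /eqP -> /eqP ->; apply: connect0.
  - exact: goodF gA.
  - by rewrite inE => /eqP ->.
  - by rewrite !inE => /eqP -> /eqP ->; rewrite lexx subxx.
have [S [f [cardS conS fF fgood fS]]] := IH (ltnW mH).
have [x xS] : exists x, x \in S by apply/card_gt0P; rewrite cardS.
have SNT : S != setT.
  by apply: contraTneq mH => ST; rewrite -cardsT -ST cardS ltnn.
have [u [v [uv uS vNS]]] := connected_set_grows econ xS SNT.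
have cmp w wS := @attached_comparable _ _ S u v w tree uv vNS wS (conS w u wS uS).
suff [D [gD DS]] : exists D, good (level v) D /\ {in S, forall w,
    ((v <= w)%O = (D \subset f w)) /\ ((w <= v)%O = (f w \subset D))}.
  have neq w : w \in S -> (w == v) = false.
    by move=> wS; apply: contraNF vNS => /eqP <-.
  exists (v |: S), (fun w => if w == v then D else f w); split.
  - by rewrite cardsU1 vNS cardS.
  - have sub a b : a \in S -> b \in S -> connect (in_S (v |: S)) a b.
      move=> aS bS; apply: connect_sub (conS a b aS bS) => c e /= /and3P [ce cS eS].
      by apply: connect1; rewrite /= ce !in_setU1 cS eS !orbT.
    have csym := restr_sym (mem (v |: S)) (@hasse_sym d H).
    have toS a : a \in v |: S -> connect (in_S (v |: S)) a u.
      rewrite in_setU1 => /predU1P [->|aS]; last exact: sub.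
      by apply: connect1; rewrite /= hasse_sym uv !in_setU1 eqxx uS orbT.
    move=> a b /toS au /toS bu; apply: (connect_trans au).
    by rewrite [connect _ _ _]csym.
  - by move=> w; case: ifP => // _; apply: goodF gD.
  - move=> w; rewrite in_setU1; case: (eqVneq w v) => [-> _|_ wS]; first exact: gD.
    exact: fgood.
  - move=> a b; rewrite !in_setU1.
    case: (eqVneq a v) => [->|_] /=; case: (eqVneq b v) => [->|_] //=.
    + by rewrite lexx subxx.
    + by move=> _ /DS [].
    + by move=> /DS [].
    + exact: fS.
have lt_le_v w : w \in S -> ((v <= w)%O = (v < w)%O) * ((w <= v)%O = (w < v)%O).
  move=> wS; have wv : w != v by apply: contraNneq vNS => <-.
  by rewrite !lt_neqAle wv eq_sym wv.
case/orP: (uv) => cuv; have ltuv := andP cuv => {cuv}; case: ltuv => ltuv _.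
- have [D [gD AD DP]] := up _ (level v) _ f (fgood u uS) (level_lt ltuv) (level_lt_height v) fF.
  exists D; split=> // w wS; rewrite !lt_le_v //.
  have [vw wv] := cmp w wS; have [DP1 DP2] := DP w; split.
    rewrite (negPf DP2); apply/negP => /vw /andP [/andP [vu _] _].
    by rewrite lt_gtF in vu.
  apply/idP/idP => [/wv /andP [_ wu]|/DP1].
    by apply: subset_trans AD; rewrite -fS.
  by rewrite -fS // => /le_lt_trans ->.
- have [D [gD DA DP]] := down _ (level v) _ f (fgood u uS) (level_lt ltuv) (level_lt_height u) fF.
  exists D; split=> // w wS; rewrite !lt_le_v //.
  have [vw wv] := cmp w wS; have [DP1 DP2] := DP w; split; last first.
    rewrite (negPf DP2); apply/negP => /wv /andP [/andP [vu _] _].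
    by rewrite lt_gtF in vu.
  apply/idP/idP => [/vw /andP [_ wu]|/DP1].
    by apply: (subset_trans DA); rewrite -fS.
  by rewrite -fS // => /(lt_le_trans ltuv).
Qed.

(** * Full chains as permutations *)

(* A permutation [t] encodes a full chain of ['I_n]: [t x] is the position at
   which [x] is added, and [chain_set t m] is the [m]-th set of the chain.       *)
Definition chain_set n (t : {perm 'I_n}) (m : nat) : {set 'I_n} :=
  [set x | t x < m].

Definition through n (A : {set 'I_n}) : {set {perm 'I_n}} :=
  [set t | chain_set t #|A| == A].

Lemma card_chain_set n (t : {perm 'I_n}) m : m <= n -> #|chain_set t m| = m.
Proof.
move=> mn; rewrite -[RHS]card_ord -!sum1_card (big_ord_widen n (fun=> 1)) //.

by rewrite [RHS](reindex_inj (@perm_inj _ t)) /=; apply: eq_bigl => x; rewrite inE.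
Qed.

Lemma chain_setS n (t : {perm 'I_n}) l m : l <= m -> chain_set t l \subset chain_set t m.
Proof. by move=> lm; apply/subsetP => x; rewrite !inE => /leq_trans ->. Qed.

Lemma throughP n (t : {perm 'I_n}) (A : {set 'I_n}) :
  reflect (forall x, (x \in A) = (t x < #|A|)) (t \in through A).
Proof.
rewrite inE; apply: (iffP eqP) => [{1}<- x|tA]; first by rewrite inE.
by apply/setP => x; rewrite inE tA.
Qed.

(** The elements that can occupy position [i] in a chain through [A]: the first [#|A|] positions are
    filled from [A], the others from its complement. *)
Definition side n (A : {set 'I_n}) (i : nat) : {set 'I_n} :=
  if i < #|A| then A else ~: A.

Lemma mem_side n (A : {set 'I_n}) i x : (x \in side A i) = ((x \in A) == (i < #|A|)).
Proof. by rewrite /side; case: ifP => _; rewrite ?inE; case: (x \in A). Qed.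

(** Swapping two elements of [side A i] preserves the chains through [A], so each of them is equally
    often at position [i], and every chain has exactly one of them there. *)
Lemma card_through_at n (A : {set 'I_n}) (x i : 'I_n) : x \in side A i ->
  #|side A i| * #|[set t in through A | t x == i]| = #|through A|.
Proof.
move=> xA.
have eq_at y : y \in side A i ->
    #|[set t in through A | t y == i]| = #|[set t in through A | t x == i]|.
  move=> yA; rewrite -(card_imset _ (mulgI (tperm x y))); apply: eq_card => t.
  have memA z : (tperm x y z \in A) = (z \in A).
    move: xA yA; rewrite !mem_side => /eqP xA /eqP yA.
    by case: tpermP => [->|->|]; rewrite ?xA ?yA.
  have thr s : (tperm x y * s)%g \in through A = (s \in through A).
    apply/throughP/throughP => sA z; last by rewrite permM -memA sA.
    by rewrite -memA sA permM tpermK.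
  apply/imsetP/setIdP => [[s /setIdP [sA sxi] ->]|[tA tyi]].
    by rewrite thr permM tpermL.
  exists (tperm x y * t)%g; last by rewrite mulgA tperm2 mul1g.
  by apply/setIdP; rewrite thr permM tpermR.
transitivity (\sum_(y in side A i) #|[set t in through A | t y == i]|).
  by rewrite (eq_bigr _ eq_at) sum_nat_const.
have cardE y : #|[set t in through A | t y == i]| = \sum_(t in through A) (t y == i).
  by rewrite -sum1_card -big_mkcondr; apply: eq_bigl => t; apply/setIdP/andP.
rewrite (eq_bigr _ (fun y _ => cardE y)).
rewrite exchange_big /= -sum1_card; apply: eq_bigr => t tA.
have yA : (t^-1)%g i \in side A i by rewrite mem_side (throughP _ _ tA) permKV.
rewrite (bigD1 ((t^-1)%g i)) //= permKV eqxx big1 // => y /andP [_ yi].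
by case: eqP => // ty; rewrite -ty permK eqxx in yi.
Qed.

(** List [A] before its complement and [B] before its complement, then match the two lists index by
    index. *)
Lemma perm_of_card_eq (T : finType) (A B : {set T}) : #|A| = #|B| ->
  exists s : {perm T}, forall x, (s x \in B) = (x \in A).
Proof.
move=> AB; pose sq (C : {set T}) := enum C ++ enum (~: C).
have memsq C x : x \in sq C by rewrite mem_cat !mem_enum inE orbN.
have uniqsq C : uniq (sq C).
  rewrite cat_uniq !enum_uniq andbT; apply/hasPn => x /=.
  by rewrite !mem_enum inE.
have sizesq C : size (sq C) = #|T| by rewrite size_cat -!cardE cardsC.
pose f x := nth x (sq B) (index x (sq A)).
have ltB x : index x (sq A) < size (sq B) by rewrite sizesq -(sizesq A) index_mem.
have f_inj : injective f.
  move=> x y; rewrite /f (set_nth_default x) // => /eqP; rewrite nth_uniq //.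
  by move=> /eqP /(congr1 (nth x (sq A))); rewrite !nth_index.
exists (perm f_inj) => x; rewrite permE /f nth_cat index_cat -!cardE AB mem_enum.
case xA: (x \in A).
  by rewrite ltnNge -AB -ltnNge cardE index_mem mem_enum xA -mem_enum
    mem_nth // -cardE -AB cardE index_mem mem_enum.
rewrite ltnNge leq_addr /=; apply/negbTE; rewrite -in_setC -mem_enum mem_nth //.
rewrite addKn -cardE; have -> : #|~: B| = #|~: A|.
  by apply: (@addnI #|B|); rewrite cardsC -AB cardsC.
by rewrite cardE index_mem mem_enum inE xA.
Qed.

Lemma card_through_eq n (A B : {set 'I_n}) : #|A| = #|B| -> #|through A| = #|through B|.
Proof.
move=> AB; have [s sAB] := perm_of_card_eq AB.
rewrite -[RHS](card_imset _ (mulgI s)); apply: eq_card => t.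
have thr r : ((s * r)%g \in through A) = (r \in through B).
  apply/throughP/throughP => tr x; last by rewrite permM -sAB tr AB.
  by rewrite -(permKV s x) sAB tr permM AB.
by rewrite -[t](mulKVg s) thr (mem_imset _ _ (mulgI s)).
Qed.

(** Every chain contains exactly one set of size [#|A|], and by symmetry all sets of that size lie
    on equally many chains. *)
Lemma card_through n (A : {set 'I_n}) : #|through A| * 'C(n, #|A|) = n`!.
Proof.
have An : #|A| <= n by rewrite -[leqRHS]card_ord max_card.
rewrite -[n in 'C(n, _)]card_ord -card_draws mulnC -sum_nat_const.
transitivity (\sum_(B : {set 'I_n} | #|B| == #|A|) #|through B|).
  by apply: eq_big => [B|B]; rewrite inE // => /eqP /card_through_eq ->.
have cardE (B : {set 'I_n}) : #|B| == #|A| ->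
    #|through B| = \sum_(t : {perm 'I_n}) (chain_set t #|A| == B).
  move=> /eqP BA; rewrite -sum1_card big_mkcond; apply: eq_bigr => t _.
  by rewrite inE BA; case: eqP.
rewrite (eq_bigr _ cardE) exchange_big /= -card_Sn -[RHS]sum1_card.
apply: eq_bigr => t _; rewrite (bigD1 (chain_set t #|A|)) ?card_chain_set //=.
rewrite eqxx big1 // => B /andP [_ /negPf pB].
by rewrite eq_sym pB.
Qed.

Lemma card_bigcup_le (I T : finType) (P : pred I) (F : I -> {set T}) :
  #|\bigcup_(i | P i) F i| <= \sum_(i | P i) #|F i|.
Proof.
elim/big_rec2: _ => [|i m X _ IH]; first by rewrite cards0.
by rewrite (leq_trans (leq_card_setU _ _)) // leq_add2l.
Qed.

(* Along a random chain through [A] a given element of [side A i] occupies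
   position [i] with probability [1 / #|side A i|]; union bound.              *)
Lemma chain_avoiding n (A : {set 'I_n}) (G : {set {perm 'I_n}}) (t D b : nat)
    (W : finType) (Y : W -> {set 'I_n * 'I_n}) :
    G \subset through A -> G != set0 -> #|through A| <= D * #|G| ->
    (forall w p, p \in Y w -> p.1 \in side A p.2 /\ t <= #|side A p.2|) ->
    (forall w, #|Y w| <= b) -> D * (#|W| * b) < t ->
  exists2 s, s \in G & forall w p, p \in Y w -> s p.1 != p.2.
Proof.
move=> GA G0 cGA Yside Yb Dt.
have [/exists_inP [s sG /forallP sY]|] :=
  boolP [exists s in G, forall w, [forall p in Y w, s p.1 != p.2]].
  by exists s => // w; apply/forall_inP/sY.
move=> /exists_inPn nG; exfalso.
pose E (p : 'I_n * 'I_n) := [set s in through A | s p.1 == p.2].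
have subG : G \subset \bigcup_(w : W) \bigcup_(p in Y w) E p.
  apply/subsetP => s sG; have := nG s sG.
  rewrite negb_forall => /existsP [w /forall_inPn [p pY /negPn sp]].
  apply/bigcupP; exists w => //; apply/bigcupP; exists p => //.
  by apply/setIdP; rewrite (subsetP GA).
have cE w p : p \in Y w -> t * #|E p| <= #|through A|.
  by move=> /Yside [pA tA]; rewrite -(card_through_at pA) leq_mul2r tA orbT.
have : t * #|G| <= #|W| * b * #|through A|.
  apply: leq_trans (_ : t * \sum_(w : W) \sum_(p in Y w) #|E p| <= _).
    rewrite leq_mul2l (leq_trans (subset_leq_card subG)) ?orbT //.
    apply: (leq_trans (card_bigcup_le _ _)).
    by apply: leq_sum => w _; apply: card_bigcup_le.
  rewrite big_distrr /= -mulnA -sum_nat_const; apply: leq_sum => w _.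
  apply: (@leq_trans (#|Y w| * #|through A|)); last by rewrite leq_mul2r Yb orbT.
  by rewrite big_distrr /= -sum_nat_const; apply: leq_sum => p; apply: cE.
rewrite leqNgt => /negP []; apply: (@leq_ltn_trans (D * (#|W| * b) * #|G|)).
  by rewrite [D * _]mulnC -[leqRHS]mulnA leq_mul2l cGA orbT.
by rewrite ltn_mul2r Dt card_gt0 G0.
Qed.

(** * Members of the family along a chain, and pruning of infrequent keys *)

Definition trace n (F : {set {set 'I_n}}) (t : {perm 'I_n}) : seq {set 'I_n} :=
  [seq chain_set t m | m <- iota 0 n.+1 & chain_set t m \in F].

Lemma mem_trace n (F : {set {set 'I_n}}) t A :
  (A \in trace F t) = (A \in F) && (t \in through A).
Proof.
apply/mapP/andP => [[m]|[AF /[!inE] /eqP tA]].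
  rewrite mem_filter mem_iota ltnS => /and3P [mF _ mn] ->.
  by rewrite mF inE card_chain_set.
exists #|A|; rewrite ?tA // mem_filter tA AF mem_iota /= add0n ltnS.
by rewrite -[leqRHS]card_ord max_card.
Qed.

Lemma trace_card_ltn n (F : {set {set 'I_n}}) t i j :
  i < j -> j < size (trace F t) -> #|nth set0 (trace F t) i| < #|nth set0 (trace F t) j|.
Proof.
pose ms := [seq m <- iota 0 n.+1 | chain_set t m \in F].
rewrite size_map -/ms => ij jt; have it := ltn_trans ij jt.
have ms_n m : m < size ms -> nth 0 ms m <= n.
  by move/(mem_nth 0); rewrite mem_filter mem_iota ltnS => /and3P [].
rewrite !(nth_map 0) // !card_chain_set ?ms_n //.
apply: (sorted_ltn_nth ltn_trans) => //.
by apply: sorted_filter (iota_ltn_sorted _ _); apply: ltn_trans.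
Qed.

Lemma uniq_trace n (F : {set {set 'I_n}}) t : uniq (trace F t).
Proof.
apply/(uniqP set0) => i j it jt eqij.
case: (ltngtP i j) => // ij; [have := trace_card_ltn ij jt | have := trace_card_ltn ij it].
  by rewrite eqij ltnn.
by rewrite eqij ltnn.
Qed.

Lemma sum_size_trace n (F : {set {set 'I_n}}) :
  \sum_(t : {perm 'I_n}) size (trace F t) = \sum_(A in F) #|through A|.
Proof.
have sizeE t : size (trace F t) = \sum_(A in F) (t \in through A).
  rewrite -(card_uniqP (uniq_trace F t)) -sum1_card -big_mkcondr.
  by apply: eq_bigl => A; rewrite mem_trace.
rewrite (eq_bigr _ (fun t _ => sizeE t)) exchange_big.
by apply: eq_bigr => A _; rewrite -sum1_card [RHS]big_mkcond; apply: eq_bigr => t _; case: ifP.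
Qed.

(* Deleting an infrequent key together with all pairs carrying it decreases
   [D * #|P|] by less than it decreases the total threshold of the keys.     *)
Lemma exists_frequent_keys (T K I : finType) (P0 : {set T}) (key : I -> T -> K)
    (thr : K -> nat) (D : nat) :
    \sum_(x in [set (i, key i p) | i in I, p in P0]) thr x.2 < D * #|P0| ->
  exists P : {set T}, [/\ P \subset P0, P != set0 & forall p i, p \in P ->
    thr (key i p) <= D * #|[set q in P | key i q == key i p]|].
Proof.
have [m] := ubnP #|P0|; elim: m P0 => // m IH P0; rewrite ltnS => cP0 lt0.
have [/forallP ok|] := boolP [forall p, forall i, (p \in P0) ==>
    (thr (key i p) <= D * #|[set q in P0 | key i q == key i p]|)].
  exists P0; split=> // [|p i pP]; last by move/forallP/(_ i)/implyP/(_ pP): (ok p).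
  by apply: contraTneq lt0 => ->; rewrite cards0 muln0.
rewrite negb_forall => /existsP [p]; rewrite negb_forall => /existsP [i].
rewrite negb_imply -ltnNge => /andP [pP small].
set C := [set q in P0 | key i q == key i p] in small.
have pC : p \in C by rewrite inE pP eqxx.
have CP : C \subset P0 by apply/subsetP => q /setIdP [].
have cardD : #|P0 :\: C| + #|C| = #|P0| by rewrite cardsD (setIidPr CP) subnK // subset_leq_card.
have C0 : 0 < #|C| by apply/card_gt0P; exists p.
have [||P [PP Pn0 Pok]] := IH (P0 :\: C).
- by apply: leq_trans cP0; rewrite -cardD -addn1 leq_add2l.
- move: lt0; rewrite -cardD mulnDr (bigD1 (i, key i p)) /=; last by apply/imset2P; exists i p.
  move=> lt0; rewrite -(ltn_add2r (D * #|C|)); apply: leq_ltn_trans lt0.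
  rewrite addnC leq_add //; first exact: ltnW.
  rewrite big_mkcond [leqRHS]big_mkcond; apply: leq_sum => x _.
  case: ifP => // /imset2P [i' q _ /setDP [qP qNC] ->]; rewrite ifT //.
  apply/andP; split; first by apply/imset2P; exists i' q.
  by apply: contra qNC => /eqP [-> kq]; rewrite inE qP kq eqxx.
- exists P; split=> //; exact: subset_trans PP (subsetDl _ _).
Qed.

(** * Extending a chain while avoiding unwanted inclusions *)

(** The size is within [s / 2] of [n / 2], stated without subtraction; two such sizes therefore
    differ by at most [s]. *)
Definition near_middle n (s : nat) (A : {set 'I_n}) : bool :=
  (n <= 2 * #|A| + s) && (2 * #|A| <= n + s).

Lemma card_side n s (A : {set 'I_n}) i : near_middle s A -> n <= 2 * #|side A i| + s.
Proof.
move=> /andP [lo hi]; rewrite /side; case: ifP => // _.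
by have := cardsC A; rewrite card_ord; lia.
Qed.

Lemma card_near_middleD n s (A B : {set 'I_n}) :
  near_middle s A -> near_middle s B -> A \subset B -> #|B :\: A| <= s.
Proof.
move=> /andP [loA hiA] /andP [loB hiB] AB.
by rewrite cardsD (setIidPr AB); lia.
Qed.

(** One chosen element of [A :\: B], packaged as a set that is empty when [A \subset B]. Where this
    element sits in a chain decides whether the inclusion in [B] fails. *)
Definition witness n (A B : {set 'I_n}) : {set 'I_n} :=
  [set y | [pick z in A :\: B] == Some y].

Lemma card_witness n (A B : {set 'I_n}) : #|witness A B| <= 1.
Proof.
rewrite /witness; case: pickP => [y _|_].
  by rewrite (_ : [set _ | _] = [set y]) ?cards1 //; apply/setP => z; rewrite !inE eq_sym.
by rewrite (_ : [set _ | _] = set0) ?cards0 //; apply/setP => z; rewrite !inE.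
Qed.

Lemma witness_sub n (A B : {set 'I_n}) : witness A B \subset A :\: B.
Proof. by apply/subsetP => y; rewrite inE; case: pickP => // z zAB /eqP [<-]. Qed.

Lemma witness_exists n (A B : {set 'I_n}) :
  ~~ (A \subset B) -> exists y, y \in witness A B.
Proof.
move=> /subsetPn [y yA yB]; rewrite /witness; case: pickP => [z _|/(_ y)].
  by exists z; rewrite inE.
by rewrite inE yA yB.
Qed.

Lemma card_interval n a s : #|[set i : 'I_n | a <= i < a + s]| <= s.
Proof.
case: s => [|s].
  rewrite (_ : [set _ | _] = set0) ?cards0 //; apply/setP => i.
  by rewrite !inE addn0; case: leqP => // ai; rewrite ltnNge ai.
rewrite -[leqRHS]card_ord.
apply: (@leq_trans #|[set (inord (i - a) : 'I_s.+1) | i : 'I_n & a <= i < a + s.+1]|);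
  last exact: max_card.
rewrite card_in_imset // => i j; rewrite !inE => ia ja /(congr1 val) /=.
by rewrite !inordK; [move=> ij; apply: val_inj => /=; lia|lia|lia].
Qed.

(* Here [Z1 w] holds a single element deciding one inclusion with the [w]-th set
   and has to avoid all of the [s] positions next to [A], while [Z2 w] may be
   large but concerns only the one position adjacent to [A].                  *)
Lemma chain_avoiding_near n s D (A : {set 'I_n}) (G : {set {perm 'I_n}}) (W : finType)
    (J I0 : {set 'I_n}) (Z1 Z2 : W -> {set 'I_n}) :
    near_middle s A -> (4 * D * #|W| + 1) * s < n ->
    G \subset through A -> G != set0 -> #|through A| <= D * #|G| ->
    #|J| <= s -> #|I0| <= 1 ->
    (forall w, #|Z1 w| <= 1) -> (forall w, #|Z2 w| <= s) ->
    (forall w y i, y \in Z1 w -> i \in J -> y \in side A i) ->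
    (forall w y i, y \in Z2 w -> i \in I0 -> y \in side A i) ->
  exists2 t, t \in G & forall w y,
    (y \in Z1 w -> t y \notin J) /\ (y \in Z2 w -> t y \notin I0).
Proof.
move=> mA sn GA G0 cG cJ cI cZ1 cZ2 ZJ ZI.
pose Y w := setX (Z1 w) J :|: setX (Z2 w) I0.
(* Each [Y w] has at most [s + s] pairs, and the lower bound on [n] makes every side of [A] larger
   than [2 * D * #|W| * s]. *)
have [||| t tG tY] := @chain_avoiding n A G (D * (#|W| * (2 * s))).+1 D (2 * s) W Y GA G0 cG.
- move=> w [y i] /= yiY; have yA : y \in side A i.
    move: yiY; rewrite in_setU !in_setX => /orP [] /andP []; [exact: ZJ|exact: ZI].
  split=> //; have := card_side i mA.
  have : (4 * D * #|W| + 1) * s = 2 * (D * (#|W| * (2 * s))) + s by lia.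
  move: sn => /[swap] ->; move: (D * _) #|side A i| => X S; clear; lia.
- move=> w; rewrite (leq_trans (leq_card_setU _ _)) // !cardsX mul2n -addnn.
  by apply: leq_add; [rewrite -[s]mul1n|rewrite -[s]muln1]; apply: leq_mul.
- by [].
exists t => // w y; split=> yZ; apply/negP => ty.
  by have := tY w (y, t y); rewrite inE !in_setX /= yZ ty eqxx => /(_ isT).
by have := tY w (y, t y); rewrite inE !in_setX /= yZ ty orbT eqxx => /(_ isT).
Qed.

(** If [A] is not inside [B w], a witness kept out of the last [s] positions of [A] survives in
    [chain_set t m]. If [B w] is inside [A], the last element of [A] is made to lie in [B w], and it
    is lost on the first step down. *)
Lemma chain_step_down n s D (A : {set 'I_n}) (G : {set {perm 'I_n}}) (W : finType)
    (B : W -> {set 'I_n}) :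
    near_middle s A -> (forall w, near_middle s (B w)) ->
    (4 * D * #|W| + 1) * s < n ->
    G \subset through A -> G != set0 -> #|through A| <= D * #|G| ->
  exists2 t, t \in G & forall m, m < #|A| -> #|A| <= m + s -> forall w,
    (chain_set t m \subset B w -> A \subset B w) /\ ~~ (B w \subset chain_set t m).
Proof.
move=> mA mB sn GA G0 cG.
pose J := [set i : 'I_n | #|A| - s <= i < #|A|].
pose I0 := [set i : 'I_n | #|A|.-1 <= i < #|A|].
pose Z2 w := if B w \subset A then A :\: B w else set0.
have [|||w|w y i yZ|w y i yZ|t tG tY] := @chain_avoiding_near n s D A G W J I0
    (fun w => witness A (B w)) Z2 mA sn GA G0 cG.
- apply: leq_trans (card_interval n (#|A| - s) s); apply/subset_leq_card/subsetP => i.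
  by rewrite !inE; lia.
- apply: leq_trans (card_interval n #|A|.-1 1); apply/subset_leq_card/subsetP => i.
  by rewrite !inE; lia.
- by move=> w; apply: card_witness.
- by rewrite /Z2; case: ifP => [BA|_]; rewrite ?cards0 // card_near_middleD.
- rewrite inE mem_side => /andP [_ ->].
  by have /setDP [-> _] := subsetP (witness_sub _ _) _ yZ.
- rewrite inE mem_side => /andP [_ ->].
  by move: yZ; rewrite /Z2; case: ifP => _; rewrite inE // => /andP [_ ->].
have tA := throughP _ _ (subsetP GA _ tG).
exists t => // m mltA Alem w; split.
  apply: contraLR => /witness_exists [y yAB].
  have [/(_ yAB) + _] := tY w y.
  have /setDP [yA yNB] := subsetP (witness_sub _ _) _ yAB.
  rewrite inE -tA yA andbT -ltnNge => ty; apply/subsetPn; exists y => //.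
  by rewrite inE; lia.
apply/negP => Bm; have BA : B w \subset A.
  by apply: subset_trans Bm _; apply/subsetP => x; rewrite inE tA => /ltn_trans ->.
have An : #|A|.-1 < n by have := max_card A; rewrite card_ord; lia.
pose x := (t^-1)%g (Ordinal An).
have tx : t x = #|A|.-1 :> nat by rewrite permKV.
have xA : x \in A by rewrite tA tx; lia.
have [_] := tY w x; rewrite /Z2 BA !inE xA andbT tx leqnn /=.
have -> : x \notin B w.
  by apply/negP => /(subsetP Bm); rewrite inE tx; lia.
by move=> /(_ isT); rewrite ltn_predL (leq_ltn_trans _ mltA).
Qed.

(** Dual to the step down: a witness of [B w :\: A] is not added within the next [s] positions, and
    when [A] is inside [B w] the first element added is made to lie outside [B w]. *)
Lemma chain_step_up n s D (A : {set 'I_n}) (G : {set {perm 'I_n}}) (W : finType)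
    (B : W -> {set 'I_n}) :
    near_middle s A -> (forall w, near_middle s (B w)) ->
    (4 * D * #|W| + 1) * s < n ->
    G \subset through A -> G != set0 -> #|through A| <= D * #|G| ->
  exists2 t, t \in G & forall m, #|A| < m -> m <= n -> m <= #|A| + s -> forall w,
    (B w \subset chain_set t m -> B w \subset A) /\ ~~ (chain_set t m \subset B w).
Proof.
move=> mA mB sn GA G0 cG.
pose J := [set i : 'I_n | #|A| <= i < #|A| + s].
pose I0 := [set i : 'I_n | #|A| <= i < #|A| + 1].
pose Z2 w := if A \subset B w then B w :\: A else set0.
have [|||w|w y i yZ|w y i yZ|t tG tY] := @chain_avoiding_near n s D A G W J I0
    (fun w => witness (B w) A) Z2 mA sn GA G0 cG.
- exact: card_interval.
- exact: card_interval.
- by move=> w; apply: card_witness.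
- by rewrite /Z2; case: ifP => [BA|_]; rewrite ?cards0 // card_near_middleD.
- rewrite inE mem_side => /andP [Ai _]; rewrite ltnNge Ai.
  by have /setDP [_ /negPf ->] := subsetP (witness_sub _ _) _ yZ.
- rewrite inE mem_side => /andP [Ai _]; rewrite ltnNge Ai.
  by move: yZ; rewrite /Z2; case: ifP => _; rewrite inE // => /andP [/negPf ->].
have tA := throughP _ _ (subsetP GA _ tG).
exists t => // m Altm mn mleA w; split.
  apply: contraLR => /witness_exists [y yBA].
  have [/(_ yBA) + _] := tY w y.
  have /setDP [yB yNA] := subsetP (witness_sub _ _) _ yBA.
  rewrite inE leqNgt -tA yNA /= -leqNgt => ty; apply/subsetPn; exists y => //.
  by rewrite inE -leqNgt (leq_trans mleA).
apply/negP => mB'; have AB : A \subset B w.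
  by apply: subset_trans _ mB'; apply/subsetP => x; rewrite inE tA => /ltn_trans ->.
have An : #|A| < n by lia.
pose x := (t^-1)%g (Ordinal An).
have tx : t x = #|A| :> nat by rewrite permKV.
have xA : x \notin A by rewrite tA tx ltnn.
have [_] := tY w x; rewrite /Z2 AB !inE xA tx leqnn addn1 ltnSn /=.
have -> : x \in B w by apply: (subsetP mB'); rewrite inE tx.
by move=> /(_ isT).
Qed.

(** * Windows of consecutive members *)

(* A pair [(t, j)] stands for the [k] consecutive members of [F] on the chain [t]
   from the [j]-th one on.  Only consecutive members are used, so that a set
   occurs at a given place in at most one window of each chain.               *)
Definition window n (F : {set {set 'I_n}}) (i : nat) (p : {perm 'I_n} * 'I_n.+1) : {set 'I_n} :=
  nth set0 (trace F p.1) (p.2 + i).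

Definition windows n (F : {set {set 'I_n}}) (k : nat) : {set {perm 'I_n} * 'I_n.+1} :=
  [set p : {perm 'I_n} * 'I_n.+1 | p.2 + k <= size (trace F p.1)].

Lemma windowP n (F : {set {set 'I_n}}) k i p : p \in windows F k -> i < k ->
  window F i p \in F /\ p.1 \in through (window F i p).
Proof.
rewrite inE => pk ik; apply/andP; rewrite -mem_trace mem_nth //.
by apply: leq_trans pk; rewrite ltn_add2l.
Qed.

Lemma window_card_ltn n (F : {set {set 'I_n}}) k i j p : p \in windows F k ->
  i < j -> j < k -> #|window F i p| < #|window F j p|.
Proof.
rewrite inE => pk ij jk; apply: trace_card_ltn; first by rewrite ltn_add2l.
by apply: leq_trans pk; rewrite ltn_add2l.
Qed.

(** A chain with [l] members carries [l - k.-1] windows; the truncation at 0 only helps the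
    inequality. *)
Lemma card_windows n (F : {set {set 'I_n}}) k : 0 < k ->
  \sum_(A in F) #|through A| <= #|windows F k| + k.-1 * n`!.
Proof.
move=> k0; have -> : #|windows F k| = \sum_(t : {perm 'I_n}) (size (trace F t) - k.-1).
  transitivity (\sum_(t : {perm 'I_n}) \sum_(j < n.+1 | j + k <= size (trace F t)) 1).
    by rewrite -sum1_card pair_big_dep /=; apply: eq_bigl => p; rewrite inE.
  apply: eq_bigr => t _; rewrite -[RHS]card_ord -sum1_card.
  rewrite [RHS](big_ord_widen n.+1 (fun=> 1)).
    by apply: eq_bigl => j; lia.
  rewrite leq_subLR (leq_trans _ (leq_addl _ _)) // size_map size_filter.
  by rewrite (leq_trans (count_size _ _)) // size_iota.
rewrite -sum_size_trace -card_Sn mulnC -sum_nat_const -big_split /=.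
apply: leq_trans (_ : \sum_(t : {perm 'I_n}) (size (trace F t) - k.-1 + k.-1) <= _).
  by apply: leq_sum => t _; lia.
by apply/eq_leq/eq_bigl => t.
Qed.

(** The thresholds [#|through A|], over all places and all sets, sum to at most the first term of
    the numerical hypothesis. With [card_windows] that hypothesis thus makes [D * #|windows F k|]
    exceed the total, so pruning leaves a nonempty collection. *)
Lemma chains_embed_tree n (F : {set {set 'I_n}}) d (H : finPOrderType d) (s D : nat) :
    is_tree (@hasse d H) -> (forall A, A \in F -> near_middle s A) ->
    (4 * D * #|H| + 1) * s < n ->
    height H * \sum_(A in F) #|through A| + D * ((height H).-1 * n`!) <
      D * \sum_(A in F) #|through A| ->
  contains_induced H F.
Proof.
move=> tree midF sn big; set k := height H in big.
have [/card_gt0P [x0 _] _ _] := tree.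
have k0 : 0 < k by apply: leq_ltn_trans (level_lt_height x0).
pose key (i : 'I_k) := window F i.
have [|P [PW P0 freq]] := @exists_frequent_keys _ _ _ (windows F k) key
    (fun A => #|through A|) D.
  apply: (@leq_ltn_trans (k * \sum_(A in F) #|through A|)).
    rewrite -[k in k * _]card_ord -sum_nat_const pair_big_dep /=.
    rewrite big_mkcond [leqRHS]big_mkcond; apply: leq_sum => x _.
    case: ifP => // /imset2P [i p _ pW ->] /=.
    by have [-> _] := windowP pW (ltn_ord i).
  rewrite -(ltn_add2r (D * (k.-1 * n`!))) (leq_trans big) //.
  by rewrite -mulnDr leq_mul2l card_windows ?orbT.
have {PW} PW p : p \in P -> p \in windows F k := subsetP PW p.
pose good i A := i < k /\ exists2 p, p \in P & window F i p = A.
have goodF i A : good i A -> A \in F.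
  by move=> [ik [p /PW pP <-]]; have [] := windowP pP ik.
pose G i A := [set q.1 | q in P & window F i q == A].
have GP i A : good i A -> [/\ G i A \subset through A, G i A != set0 &
    #|through A| <= D * #|G i A|].
  move=> [ik [p pP <-]]; split.
  - apply/subsetP => t /imsetP [q /setIdP [/PW qP /eqP <-] ->].
    by have [] := windowP qP ik.
  - by apply/set0Pn; exists p.1; apply/imsetP; exists p => //; apply/setIdP.
  (* [freq] counts windows while [G i A] counts chains. The counts agree: [A] occurs once in a
     trace, so its place [i] determines where the window starts. *)
  rewrite card_in_imset ?(freq p (Ordinal ik)) //.
  move=> [t a] [t' b] /setIdP [/PW ta /eqP Ea] /setIdP [/PW tb /eqP Eb] /= tt'.
  rewrite inE /= in ta; rewrite inE /= in tb.
  case: t' / tt' tb Eb => tb; rewrite -Ea /key /window /= => /eqP.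
  rewrite nth_uniq ?uniq_trace ?eqn_add2r //; first by move=> /eqP /val_inj ->.
    by apply: leq_trans tb; rewrite ltn_add2l.
  by apply: leq_trans ta; rewrite ltn_add2l.
apply: (@tree_embedding _ H _ F good) => // [i ik|i j A B gA ji ik BF|i j A B gA ij jk BF].
- have /set0Pn [p pP] := P0.
  by exists (window F i p); split=> //; exists p.
- have [GA Gn0 cG] := GP i A gA.
  (* The chain obtained belongs to a kept window [q] with [A] at place [i]. Its set at place [j] is
     the new image, at most [s] levels away since both sets are near the middle. *)
  have [t /imsetP [q /setIdP [qP /eqP qA] ->] tB] := @chain_step_down n s D A (G i A) H B
    (midF _ (goodF _ _ gA)) (fun w => midF _ (BF w)) sn GA Gn0 cG.
  have jk := ltn_trans ji ik; have [DF /[!inE] /eqP tD] := windowP (PW q qP) jk.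
  have ltDA := window_card_ltn (PW q qP) ji ik; rewrite qA in ltDA.
  have [tA _] := windowP (PW q qP) ik.
  exists (window F j q); split.
  + by split=> //; exists q.
  + have := subsetP GA q.1; rewrite inE => /(_ _) /eqP <-; last first.
      by apply/imsetP; exists q => //; apply/setIdP; rewrite qA.
    by rewrite -tD chain_setS // ltnW.
  + rewrite -tD; apply: tB => //.
    have /andP [_ hiA] := midF _ (goodF _ _ gA); have /andP [loD _] := midF _ DF.
    lia.
- have [GA Gn0 cG] := GP i A gA.
  have [t /imsetP [q /setIdP [qP /eqP qA] ->] tB] := @chain_step_up n s D A (G i A) H B
    (midF _ (goodF _ _ gA)) (fun w => midF _ (BF w)) sn GA Gn0 cG.
  have [DF /[!inE] /eqP tD] := windowP (PW q qP) jk.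
  have ltAD := window_card_ltn (PW q qP) ij jk; rewrite qA in ltAD.
  exists (window F j q); split.
  + by split=> //; exists q.
  + have := subsetP GA q.1; rewrite inE => /(_ _) /eqP <-; last first.
      by apply/imsetP; exists q => //; apply/setIdP; rewrite qA.
    by rewrite -tD chain_setS // ltnW.
  + rewrite -tD; apply: tB => //; first by rewrite -[leqRHS]card_ord max_card.
    have /andP [loA _] := midF _ (goodF _ _ gA); have /andP [_ hiD] := midF _ DF.
    lia.
Qed.

(** * Binomial tails *)

Lemma bin_le_half n m : 'C(n, m) <= 'C(n, n./2).
Proof.
have lower j i : 2 * (i + j) <= n -> 'C(n, i) <= 'C(n, i + j).
  elim: j => [|j IH] ij; first by rewrite addn0.
  apply: leq_trans (IH _) _; first by lia.
  rewrite addnS -(@leq_pmul2l (i + j).+1) // mul_bin_left leq_mul2r.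
  by apply/orP; right; lia.
have half i : 2 * i <= n -> 'C(n, i) <= 'C(n, n./2).
  move=> im; have := lower (n./2 - i) i; rewrite subnKC; last by lia.
  by apply; lia.
have [mn|nm] := leqP m n; last by rewrite bin_small.
have [|lt] := leqP (2 * m) n; first exact: half.
by rewrite -bin_sub // half //; lia.
Qed.

Lemma bin_geometric Q r n m :
    (forall i, i < r -> (m + i).+1 * Q.+1 <= (n - (m + i)) * Q) ->
  'C(n, m) * Q.+1 ^ r <= 'C(n, m + r) * Q ^ r.
Proof.
elim: r => [|r IH] ratio; first by rewrite !expn0 addn0.
have step : 'C(n, m + r) * Q.+1 <= 'C(n, m + r.+1) * Q.
  rewrite -(@leq_pmul2l (m + r).+1) // addnS !mulnA mul_bin_left.
  by rewrite mulnAC [leqRHS]mulnAC leq_mul2r ratio ?orbT.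
rewrite !expnS !mulnA; apply: leq_trans (_ : 'C(n, m + r) * Q.+1 * Q ^ r <= _); last first.
  by rewrite leq_mul2r step orbT.
rewrite mulnAC [leqRHS]mulnAC leq_mul2r IH ?orbT // => i ir.
by apply: ratio; apply: ltnW.
Qed.

(** A single term of the binomial expansion of [(Q + 1) ^ r], namely ['C(r, 2) * Q ^ (r - 2)],
    already suffices. *)
Lemma quadratic_le_exponential c Q r :
  1 < r -> c * Q ^ 2 <= 'C(r, 2) -> c * Q ^ r <= Q.+1 ^ r.
Proof.
case: r => [|[|r]] // _ cQ; rewrite -[r.+2]addn2 addnC expnD mulnA.
apply: leq_trans (leq_mul cQ (leqnn (Q ^ r))) _.
rewrite -[Q.+1]addn1 expnDn.
have lt2 : 2 < (2 + r).+1 by [].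
by rewrite (bigD1 (Ordinal lt2)) //= addKn exp1n muln1 leq_addr.
Qed.

Lemma card_sets_of_card (T : finType) (P : pred nat) :
  #|[set A : {set T} | P #|A|]| = \sum_(m < #|T|.+1 | P m) 'C(#|T|, m).
Proof.
have ltT (A : {set T}) : #|A| < #|T|.+1 by rewrite ltnS max_card.
rewrite -sum1_card (partition_big (fun A : {set T} => Ordinal (ltT A)) P) /=; last first.
  by move=> A; rewrite inE.
apply: eq_bigr => m Pm; rewrite -card_draws -[RHS]sum1_card; apply: eq_bigl => A.
by rewrite !inE -val_eqE /=; case: eqP => [->|]; rewrite ?Pm ?andbF.
Qed.

(** From a tail layer, [r] steps towards the middle each multiply the binomial coefficient by at
    least [1 + 1 / Q]. The resulting factor beats [2 * e] times the number [n.+1] of layers. *)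
Lemma card_lower_tail e q n : 0 < q -> 4 * q * (64 * e * q ^ 3 + 3) <= n ->
  2 * e * #|[set A : {set 'I_n} | 2 * #|A| + n %/ q < n]| <= 'C(n, n./2).
Proof.
move=> q0 large; pose r := n %/ (4 * q); pose Q := 2 * q.
have q4 : 0 < 4 * q by rewrite muln_gt0.
have lt_n : n < 4 * q * r.+1 by rewrite mulnC ltn_ceil.
have ge_n : 4 * q * r <= n by rewrite mulnC leq_trunc_div.
have r_large : 64 * e * q ^ 3 + 3 <= r by rewrite leq_divRL // mulnC.
have s_r : 4 * r <= n %/ q by rewrite leq_divRL //; lia.
have term m : 2 * m + n %/ q < n -> n.+1 * (2 * e) * 'C(n, m) <= 'C(n, n./2).
  move=> mn; have geo : 'C(n, m) * Q.+1 ^ r <= 'C(n, n./2) * Q ^ r.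
    apply: leq_trans (bin_geometric _) _ => [i ir|]; last by rewrite leq_mul2r bin_le_half orbT.
    suff : (m + i).+1 <= (n - 2 * (m + i) - 1) * Q by rewrite /Q; nia.
    apply: (@leq_trans n); first by lia.
    apply: (@leq_trans (2 * r.+1 * Q)); first by rewrite /Q; lia.
    by rewrite leq_mul2r; apply/orP; right; lia.
  have exp : n.+1 * (2 * e) * Q ^ r <= Q.+1 ^ r.
    apply: quadratic_le_exponential; first by lia.
    (* As [n.+1 <= 4 * q * r.+1] and [Q = 2 * q], the constants multiply to [64 * e * q ^ 3]; the
       extra 3 in [r_large] turns [r.+1] into the bound by [r * r.-1]. *)
    have : n.+1 * (2 * e) * Q ^ 2 * 2 <= 64 * e * q ^ 3 * r.+1.
      rewrite (_ : 64 * e * q ^ 3 * r.+1 = 4 * q * r.+1 * (2 * e) * Q ^ 2 * 2);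
        last by rewrite /Q; lia.
      by rewrite !leq_mul2r lt_n !orbT.
    have := mul_bin_diag r 1; rewrite bin1.
    have aux X K B i : K + 3 <= i -> i * i.-1 = 2 * B -> X * 2 <= K * i.+1 -> X <= B.
      by case: i => // i; nia.
    exact: aux r_large.
  have Q0 : 0 < Q ^ r by rewrite expn_gt0 muln_gt0 q0.
  rewrite -(leq_pmul2r Q0); apply: leq_trans geo.
  by rewrite mulnAC mulnC leq_mul2l exp orbT.
rewrite (@card_sets_of_card 'I_n (fun m => 2 * m + n %/ q < n)) card_ord.
rewrite -(@leq_pmul2l n.+1) // mulnA big_distrr /=.
apply: (@leq_trans (\sum_(m < n.+1) 'C(n, n./2))); last by rewrite sum_nat_const card_ord.
by rewrite big_mkcond; apply: leq_sum => m _; case: ifP => // /term.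
Qed.

(** Complementation maps the upper tail into the lower one, which accounts for the factor 2 in
    [card_lower_tail]. *)
Lemma card_tails e q n : 0 < q -> 4 * q * (64 * e * q ^ 3 + 3) <= n ->
  e * #|[set A : {set 'I_n} | ~~ near_middle (n %/ q) A]| <= 'C(n, n./2).
Proof.
move=> q0 large; apply: leq_trans (card_lower_tail q0 large).
set L := [set A | _ < n]; rewrite [2 * e]mulnC -mulnA leq_mul2l; apply/orP; right.
apply: (@leq_trans #|L :|: [set ~: A | A in L]|).
  apply/subset_leq_card/subsetP => A; rewrite !inE negb_and -!ltnNge.
  case/orP => [->//|hi]; apply/orP; right; apply/imsetP; exists (~: A); last by rewrite setCK.
  by rewrite inE; have := cardsC A; rewrite card_ord; lia.
by rewrite (leq_trans (leq_card_setU _ _)) // mul2n -addnn leq_add2l leq_imset_card.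
Qed.

(** * Restriction to the middle layers and proof of the theorem *)

Lemma tree_in_dense_family d (H : finPOrderType d) (e : nat) :
    is_tree (@hasse d H) -> 0 < e ->
  exists n0, forall n, 0 < n -> n0 <= n -> forall F : {set {set 'I_n}},
    (e * (height H).-1 + 1) * 'C(n, n./2) <= e * #|F| -> contains_induced H F.
Proof.
(* Dropping the tails halves the excess [1 / e], leaving density [a.+1 / (2 * e)]. [D] is chosen so
   that [D] times the number of windows exceeds [k * W], and [q] so that [s = n %/ q] is small
   enough for the chain steps. *)
move=> tree e0; pose k := height H; pose a := 2 * e * k.-1.
pose D := k * a.+1 + 1; pose q := 4 * D * #|H| + 2.
exists (4 * q * (64 * (2 * e) * q ^ 3 + 3)) => n n_gt0 large F cF.
have q0 : 0 < q by rewrite /q addn2.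
pose s := n %/ q; pose F' := [set A in F | near_middle s A].
have tails := card_tails q0 large.
have cF' : a.+1 * 'C(n, n./2) <= 2 * e * #|F'|.
  have : #|F| <= #|F'| + #|[set A : {set 'I_n} | ~~ near_middle s A]|.
    rewrite -cardsUI (leq_trans _ (leq_addr _ _)) //; apply/subset_leq_card/subsetP => A AF.
    by rewrite !inE AF /= orbN.
  move: tails cF; rewrite -/s -/k /a; set t := #|[set A | _]|; nia.
have C0 : 0 < 'C(n, n./2) by rewrite bin_gt0; lia.
set W := \sum_(A in F') #|through A|.
(* [W] is [n!] times the mean number of members of [F'] on a random chain; each member contributes
   at least [1 / 'C(n, n./2)] to that mean. *)
have cW : #|F'| * n`! <= W * 'C(n, n./2).
  rewrite -sum_nat_const big_distrl; apply: leq_sum => A _.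
  by rewrite -(card_through A) leq_mul2l bin_le_half orbT.
have W_large : a.+1 * n`! <= 2 * e * W.
  rewrite -(leq_pmul2r C0) mulnAC; apply: leq_trans (leq_mul cF' (leqnn _)) _.
  by rewrite -!mulnA leq_mul2l leq_mul2l cW !orbT.
have W0 : 0 < W.
  rewrite lt0n; apply: contraTneq W_large => ->.
  by rewrite muln0 -ltnNge muln_gt0 fact_gt0.
have [f [f_inj fF' fle]] : contains_induced H F'.
  apply: (@chains_embed_tree _ _ _ _ s D) => // [A /setIdP [] //||].
    have : s * q <= n by rewrite leq_trunc_div.
    by rewrite /q mulnC; move: (s) (4 * D * #|H|) => r b; case: r => [|r]; lia.
  rewrite -/k -/W.
  (* At least a fraction [1 / a.+1] of [W] remains after subtracting [k.-1 * n!], the part lost when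
     counting windows. *)
  have key : W + a.+1 * (k.-1 * n`!) <= a.+1 * W.
    by have := leq_mul (leqnn k.-1) W_large; rewrite /a; lia.
  have lt_W : k.-1 * n`! < W.
    rewrite -(ltn_pmul2l (ltn0Sn a)); apply: leq_trans key.
    by rewrite -[ltnLHS]add0n ltn_add2r.
  move: (leq_mul (leqnn k) key) lt_W; rewrite /D.
  by move: (W) (k.-1 * n`!) a.+1 (k) => w x b i; clear; lia.
by exists f; split=> // u; have /setIdP [] := fF' u.
Qed.

Local Open Scope ring_scope.

Theorem theorem1p3 (R : realType) (d : Order.disp_t) (H : finPOrderType d)
    (k : nat) (hk : (2 <= k)%N) (htree : is_tree (@hasse d H))
    (hheight : height H = k) (eps : R) (heps : 0 < eps) :
  exists n0 : nat, forall n : nat, (0 < n)%N -> (n0 <= n)%N ->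
    forall F : {set {set 'I_n}},
      (k%:R - 1 + eps) * ('C(n, n./2))%:R <= (#|F|)%:R ->
      contains_induced H F.
Proof.
have ei : 0 < eps^-1 by rewrite invr_gt0.
(* Replacing [eps] by the smaller [1 / e] reduces the claim to natural number arithmetic. *)
pose e := Num.bound eps^-1.
have e_large : eps^-1 < e%:R by apply: archi_boundP; apply: ltW.
have e0 : (0 < e)%N by rewrite -(ltr_nat R) (lt_trans ei).
have [n0 Hn0] := tree_in_dense_family htree e0.
exists n0 => n n_gt0 n0n F cF; apply: Hn0 => //.
rewrite hheight -(ler_nat R) !natrM natrD natrM.
apply: le_trans (ler_wpM2l (ler0n R e) cF); rewrite mulrA ler_wpM2r ?ler0n //.
have -> : k.-1%:R = k%:R - 1 :> R by rewrite -subn1 natrB // ltnW.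
by rewrite [leRHS]mulrDr lerD2l -ler_pdivrMr // div1r ltW.
Qed.
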